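(* Let $n\ge 2$ and $s=(2,3,\ldots,n)$ (a sequence of length $n-1$). Then the $s$-derangement polynomial satisfies $d_{n-1}^s(z)=d_n(z)$, the classical derangement polynomial. Moreover, the local $h$-polynomial of the barycentric subdivision of the $(n-1)$-simplex $2^{[n]}$ equals the local $h^\ast$-polynomial $\ell^\ast(P_{n-1}^s;z)$ of the $s$-lecture hall simplex $P_{n-1}^s$.
   Context: $P_{m}^s=\{x\in\mathbb{R}^{m}: 0\le x_1/s_1\le\cdots\le x_{m}/s_{m}\le 1\}$ for $s=(s_1,\ldots,s_m)$; for a lattice $d$-simplex $\Delta=\mathrm{conv}(v^{(0)},\ldots,v^{(d)})\subset\mathbb{R}^m$, $\ell^\ast(\Delta;z)=\sum_{x\in\Pi^\circ_\Delta\cap\mathbb{Z}^{m+1}}z^{x_{m+1}}$ with $\Pi^\circ_\Delta=\{\sum_i\lambda_i(v^{(i)},1): 0<\lambda_i<1\}$; $d_m^s(z):=\ell^\ast(P_m^s;z)$. The derangement polynomial is $d_n(z)=\sum_{\pi\in\mathfrak{D}_n}z^{\mathrm{exc}(\pi)}$, where $\mathfrak{D}_n$ is the set of permutations of $[n]$ without fixed points and $\mathrm{exc}(\pi)=|\{i:\pi_i>i\}|$. For a $(d-1)$-dimensional simplicial complex $\Omega$ with $f_{i-1}$ faces of dimension $i-1$ ($f_{-1}=1$), $h(\Omega;z)=\sum_{i=0}^d f_{i-1}z^i(1-z)^{d-i}$. If $\Omega$ is a subdivision of the simplex $2^V$, $|V|=n$, and for $F\subseteq V$ $\Omega_F$ denotes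 the restriction of $\Omega$ to the face $F$ (the subcomplex subdividing $2^F$; $h(\Omega_\emptyset;z)=1$), the local $h$-polynomial is $\ell_V(\Omega_V;z)=\sum_{F\subseteq V}(-1)^{n-|F|}h(\Omega_F;z)$. *)

(* Defs.v *)
From Stdlib Require Import Reals.
From mathcomp Require Import all_boot all_order all_algebra all_fingroup.
From mathcomp Require Import boolp.
From mathcomp Require Import Rstruct.
Set Implicit Arguments. Unset Strict Implicit. Unset Printing Implicit Defensive.
Import Order.TTheory GRing.Theory Num.Theory.
Local Open Scope ring_scope.

(* A lattice d-simplex in R^m is given by its vertices v i (i = 0..d),
   v i : 'I_m -> int.  A point (y, t) of Z^m x Z lies in the open
   fundamental parallelepiped Pi^o iff
   (y, t) = sum_i lambda_i (v i, 1) with 0 < lambda_i < 1 (lambda real). *)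
Definition in_open_par (m d : nat) (v : 'I_d.+1 -> 'I_m -> int)
  (y : 'I_m -> int) (t : int) : Prop :=
  exists lam : 'I_d.+1 -> R,
    (forall i, 0 < lam i < 1) /\
    (forall j, (y j)%:~R = \sum_(i < d.+1) lam i * (v i j)%:~R) /\
    t%:~R = \sum_(i < d.+1) lam i.

(* A bound on the coordinates of points of Pi^o : |y_j| <= sum |v i j|. *)
Definition par_bound (m d : nat) (v : 'I_d.+1 -> 'I_m -> int) : nat :=
  (\sum_(i < d.+1) \sum_(j < m) `|v i j|%N).+1.

(* l^*(Delta; z) = sum over lattice points x of Pi^o of z^(x_{m+1}).
   Lattice points of Pi^o have all |y_j| < par_bound and 0 < t < d+1,
   so we enumerate the finite box y_j in [-B, B], t in [0, d]. *)
Definition lstar (m d : nat) (v : 'I_d.+1 -> 'I_m -> int) : {poly int} :=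
  let B := par_bound v in
  \sum_(y : {ffun 'I_m -> 'I_(B.*2.+1)})
   \sum_(t < d.+1)
     (if `[< in_open_par v (fun j => (y j)%:Z - B%:Z) t%:Z >] then 'X^t else 0).

(* P_m^s = { x : 0 <= x_1/s_1 <= ... <= x_m/s_m <= 1 } has vertices
   v^(i) = (0,...,0, s_{i+1}, ..., s_m), i = 0..m (0-based coordinates:
   v^(i)_j = s_j if j >= i, and 0 otherwise). *)
Definition lhs_vertex (m : nat) (s : 'I_m -> nat) : 'I_m.+1 -> 'I_m -> int :=
  fun i j => if (i <= j)%N then (s j)%:Z else 0.

Definition s_derangement (m : nat) (s : 'I_m -> nat) : {poly int} :=
  lstar (lhs_vertex s).

Definition s_seq (n : nat) : 'I_n.-1 -> nat := fun j => (j + 2)%N.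
Arguments s_seq n : clear implicits.

Definition derangement_poly (n : nat) : {poly int} :=
  \sum_(p : 'S_n | [forall i, p i != i]) 'X^(#|[set i : 'I_n | (i < p i)%N]|).

(* h-polynomial of a (d-1)-dimensional simplicial complex given by its set of
   faces (the empty face included): sum_{i=0}^d f_{i-1} z^i (1-z)^(d-i),
   where f_{i-1} = number of faces with i vertices. *)
Definition h_poly (T : finType) (d : nat) (Om : {set {set T}}) : {poly int} :=
  \sum_(i < d.+1) (#|[set sg in Om | #|sg| == i]|)%:R *: ('X^i * (1 - 'X)^+(d - i)).

(* Local h-polynomial of a subdivision Om of the simplex 2^V, V = 'I_n, given
   by its restrictions Om_F to the faces F of 2^V (Om_F subdivides 2^F). *)
Definition local_h (n : nat) (T : finType) (OmF : {set 'I_n} -> {set {set T}})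
  : {poly int} :=
  \sum_(F : {set 'I_n}) (-1) ^+ (n - #|F|) *: h_poly #|F| (OmF F).

(* Barycentric subdivision of 2^F: vertices are the nonempty subsets of F,
   faces are the chains (totally ordered by inclusion) of such subsets. *)
Definition bary_restr (n : nat) (F : {set 'I_n}) : {set {set {set 'I_n}}} :=
  [set C : {set {set 'I_n}} |
     [forall S in C, (S != set0) && (S \subset F)] &&
     [forall S in C, forall S' in C, (S \subset S') || (S' \subset S)]].

(* Main.v *)
Require Import Defs.
From HB Require Import structures.
From mathcomp Require Import all_boot all_order all_algebra all_fingroup.
From mathcomp Require Import boolp Rstruct.
From mathcomp Require Import zify ring.
Import Order.TTheory GRing.Theory Num.Theory.
Set Implicit Arguments. Unset Strict Implicit. Unset Printing Implicit Defensive.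
Local Open Scope ring_scope.

(* All three polynomials are shown to equal [lh_poly n 0], where [lh_poly] is a two-index
   family given by a transfer recurrence.

   Lattice points: a point of the open parallelepiped is an integer sequence [y] with
   [y_0 = 0] whose ratios [y_j / (j + 1)] increase by amounts in (0, 1).  Writing
   [y_j = k (j + 1) + e] with [0 <= e <= j], the number of admissible prefixes ending at
   [y_j] is the coefficient of [X^k] in [lh_poly j e].

   Derangements: [d_n] is the permanent of the matrix with [1] below, [0] on and [X] above
   the diagonal.  Expanding along the first row leaves minors [exc_mx], whose permanents
   satisfy the recurrence of [lh_poly].

   Local h-polynomial: summing over the largest element of a chain expresses the
   h-polynomials of the barycentric subdivisions of the faces recursively.  The linear
   functional [umbral], which sends [Y^j] to [lh_poly j 0], satisfies the same recursion at
   [(Y + 1)^k], so these h-polynomials are [umbral ((Y + 1)^k)], and the alternating sum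
   over faces is [umbral (Y^n)]. *)

(* Weight enumerator of the sequences [e_0, ..., e_n] with [0 <= e_j <= j] and last term
   [e'] whose ratios [e_j / (j + 1)] are consecutively distinct, counting [X] for each
   descent of the ratios; these descend from [e] to [e'] exactly when [e' <= e], unless
   both terms are [0]. *)
Fixpoint lh_poly (n e' : nat) : {poly int} :=
  if n is m.+1 then
    \sum_(e < n)
      (if (e < e')%N then 1 else if (e == 0 :> nat) && (e' == 0) then 0 else 'X) * lh_poly m e
  else (e' == 0)%:R.

(** * Difference rules for the transfer recurrence *)

Lemma lh_poly00 : lh_poly 0 0 = 1.
Proof. by []. Qed.

Lemma lh_polyS0 n : lh_poly n.+1 0 = 'X * \sum_(e < n) lh_poly n e.+1.
Proof.
rewrite /= big_ord_recl /= mul0r add0r mulr_sumr.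
by apply: eq_bigr.
Qed.

Lemma lh_polyS1 n : lh_poly n.+1 1 = lh_poly n.+1 0 + lh_poly n 0.
Proof.
rewrite lh_polyS0 /= big_ord_recl /= mul1r addrC mulr_sumr; congr (_ + _).
Qed.

(** Passing from [e] to [e.+1] changes a single weight, that of the predecessor [e], from ['X] to
    [1]. For [e = 0] this weight starts at [0] instead, which gives [lh_polyS1]. *)
Lemma lh_polySS n e : (0 < e <= n)%N ->
  lh_poly n.+1 e.+1 = lh_poly n.+1 e + (1 - 'X) * lh_poly n e.
Proof.
case/andP=> e0 len; have eo : (e < n.+1)%N by [].
rewrite /= (bigD1 (Ordinal eo)) //= [in RHS](bigD1 (Ordinal eo)) //= ltnSn ltnn.
rewrite (gtn_eqF e0) addrAC -mulrDl [_ + (1 - 'X)]addrC subrK; congr (_ + _).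
apply: eq_bigr => i; rewrite -val_eqE /= => ie.
by rewrite ltnS leq_eqVlt (negPf ie).
Qed.

Lemma lh_polySn n : lh_poly n.+1 n.+1 = \sum_(e < n.+1) lh_poly n e.
Proof. by rewrite /=; apply: eq_bigr => i _; rewrite ltn_ord mul1r. Qed.

Lemma lh_polyS n e' : lh_poly n.+1 e' = \sum_(e < n.+1)
  (if (e < e')%N then 1 else if (e == 0 :> nat) && (e' == 0) then 0 else 'X) * lh_poly n e.
Proof. by []. Qed.

Arguments lh_poly : simpl never.

(** * Permanents and the derangement polynomial *)

Definition permanent (R : comNzRingType) n (A : 'M[R]_n) : R :=
  \sum_(s : 'S_n) \prod_i A i (s i).

Lemma permanent_expand (R : comNzRingType) n (A : 'M[R]_n.+1) i0 :
  permanent A = \sum_j A i0 j * permanent (row' i0 (col' j A)).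
Proof.
(* A permutation amounts to the image [j] of [i0] and a permutation of the rest; bijectivity follows
   from injectivity and [(n + 1) * n! = (n + 1)!]. *)
have lift_bij : bijective (fun u : 'I_n.+1 * 'S_n => lift_perm i0 u.1 u.2).
  apply: inj_card_bij => [[j s] [k t] /= eq_st|].
    have jk : j = k by rewrite -(lift_perm_id i0 j s) eq_st lift_perm_id.
    rewrite -{}jk in eq_st *; congr (_, _); apply/permP => i.
    by apply: (@lift_inj _ j); rewrite -!(lift_perm_lift i0) eq_st.
  by rewrite card_prod card_ord !card_Sn factS.
rewrite /permanent (reindex _ (onW_bij _ lift_bij)) /=.
rewrite -(pair_bigA _ (fun j s => \prod_i A i (lift_perm i0 j s i))) /=.
apply: eq_bigr => j _; rewrite mulr_sumr; apply: eq_bigr => s _.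
rewrite (bigD1_ord i0) //= lift_perm_id; congr (_ * _).
by apply: eq_bigr => i _; rewrite !mxE lift_perm_lift.
Qed.

Lemma permanent_row_perm (R : comNzRingType) n (A : 'M[R]_n) s :
  permanent (row_perm s A) = permanent A.
Proof.
rewrite /permanent (reindex_inj (@mulgI _ s)); apply: eq_bigr => t _ /=.
rewrite [RHS](reindex_inj (@perm_inj _ s)); apply: eq_bigr => i _.
by rewrite mxE permM.
Qed.

(** The permanent is affine in each entry, with the complementary minor as slope. *)
Lemma permanent_row_eq (R : comNzRingType) n (A B : 'M[R]_n.+1) i0 k :
    (forall i j, (i != i0) || (j != k) -> A i j = B i j) ->
  permanent A = permanent B + (A i0 k - B i0 k) * permanent (row' i0 (col' k B)).
Proof.
move=> eqAB; rewrite !(permanent_expand _ i0) (bigD1 k) //= [in RHS](bigD1 k) //=.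
have eq_minor j : row' i0 (col' j A) = row' i0 (col' j B).
  by apply/matrixP => r c; rewrite !mxE eqAB // eq_sym neq_lift.
rewrite eq_minor [in RHS]addrAC -mulrDl [B _ _ + _]addrC subrK; congr (_ + _).
by apply: eq_bigr => j jk; rewrite eq_minor eqAB // jk orbT.
Qed.

(* [exc_mx n 0] is the weight matrix of derangements; for [0 < e], [exc_mx n e] is
   what remains of [exc_mx n.+1 0] after deleting row [0] and column [e]. *)
Definition exc_entry (e i j : nat) : {poly int} :=
  if (i.+1 < e)%N then (if (j <= i)%N then 1 else if (i.+1 < j)%N then 'X else 0)
  else if (i < e)%N then (if (j <= i)%N then 1 else 'X)
  else (if (j < i)%N then 1 else if (i < j)%N then 'X else 0).

Definition exc_mx n e : 'M[{poly int}]_n := \matrix_(i, j) exc_entry e i j.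

(** A fixed point meets the zero diagonal, and each exceedance contributes one ['X]. *)
Lemma derangement_permanent n : derangement_poly n = permanent (exc_mx n 0).
Proof.
rewrite /derangement_poly /permanent big_mkcond /=; apply: eq_bigr => s _.
case: forallP => [sP | /forallP]; last first.
  rewrite negb_forall => /existsP [i]; rewrite negbK => /eqP si.
  by rewrite (bigD1 i) //= mxE si /exc_entry !ltnn mul0r.
rewrite -prodr_const big_mkcond /=; apply: eq_bigr => i _.
rewrite mxE /exc_entry /= inE; have := sP i; rewrite -val_eqE /= => si.
by case: ltngtP si.
Qed.

Lemma exc_minor0 n (c : 'I_n) :
  row' 0 (col' (lift 0 c) (exc_mx n.+1 0)) = exc_mx n c.+1.
Proof.
have entryE (i j : nat) : exc_entry 0 i.+1 (bump c.+1 j) = exc_entry c.+1 i j.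
  rewrite /exc_entry /bump; case: (leqP c.+1 j) => ?; rewrite ?add1n ?add0n;
    repeat (case: ifP => ?); (done || (exfalso; lia)).
by apply/matrixP => i j; rewrite !mxE; apply: entryE.
Qed.

(** This is the minor of the single entry in which, up to a row exchange, the matrices for [e] and
    [e.+1] differ; it supplies the lower-order term of the recurrences. *)
Lemma exc_minor_diag n (e : 'I_n.+1) :
  row' e (col' e (exc_mx n.+1 e.+1)) = exc_mx n e.
Proof.
have entryE (i j : nat) : exc_entry e.+1 (bump e i) (bump e j) = exc_entry e i j.
  rewrite /exc_entry /bump; case: (leqP e j) => ?; case: (leqP e i) => ?;
    rewrite ?add1n ?add0n; repeat (case: ifP => ?); (done || (exfalso; lia)).
by apply/matrixP => i j; rewrite !mxE; apply: entryE.
Qed.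

Lemma permanent_excS0 n :
  permanent (exc_mx n.+1 0) = 'X * \sum_(e < n) permanent (exc_mx n e.+1).
Proof.
rewrite (permanent_expand _ 0) big_ord_recl mxE mul0r add0r mulr_sumr.
by apply: eq_bigr => c _; rewrite exc_minor0 mxE.
Qed.

Lemma permanent_excS1 n :
  permanent (exc_mx n.+1 1) = permanent (exc_mx n.+1 0) + permanent (exc_mx n 0).
Proof.
rewrite [RHS]addrC.
(* The two matrices differ only at [(0, 0)], where the entries are [0] and [1]. *)
rewrite [in RHS](@permanent_row_eq _ _ (exc_mx n.+1 0) (exc_mx n.+1 1) 0 0).
  by rewrite exc_minor_diag !mxE /exc_entry /=; ring.
move=> i j; rewrite !mxE -!val_eqE /exc_entry /= => ij.
by repeat (case: ifP => ?); (done || (exfalso; lia)).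
Qed.

(* Exchanging rows [e - 1] and [e] of [exc_mx n.+1 e] yields [exc_mx n.+1 e.+1],
   except for the entry at [(e, e)]. *)
Lemma permanent_excSS n e : (0 < e <= n)%N ->
  permanent (exc_mx n.+1 e.+1) =
  permanent (exc_mx n.+1 e) + (1 - 'X) * permanent (exc_mx n e).
Proof.
case/andP=> e0 len; have eo : (e < n.+1)%N by [].
have po : (e.-1 < n.+1)%N by lia.
rewrite -(permanent_row_perm (exc_mx n.+1 e) (tperm (Ordinal po) (Ordinal eo))).
set A := row_perm _ _.
rewrite (@permanent_row_eq _ _ A (exc_mx n.+1 e.+1) (Ordinal eo) (Ordinal eo)).
  (* At [(e, e)] the exchanged matrix has ['X] and the target has [1], whence the factor
     [1 - 'X]. *)
  have eqX : exc_entry e e.-1 e = 'X.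
    by rewrite /exc_entry prednK // ltnn leqnn leqNgt ltn_predL e0.
  have eq1 : exc_entry e.+1 e e = 1 by rewrite /exc_entry ltnn ltnSn leqnn.
  by rewrite exc_minor_diag !mxE tpermR /= eqX eq1; ring.
move=> i j; rewrite !mxE -!val_eqE /=; case: tpermP => [->|->|/eqP + /eqP].
- rewrite /exc_entry /= => _.
  by repeat (case: ifP => ?); (done || (exfalso; lia)).
- rewrite /exc_entry /= eqxx /= => ?.
  by repeat (case: ifP => ?); (done || (exfalso; lia)).
rewrite -!val_eqE /exc_entry /= => ? ? _.
by repeat (case: ifP => ?); (done || (exfalso; lia)).
Qed.

Lemma permanent_exc n e : (e <= n)%N -> permanent (exc_mx n e) = lh_poly n e.
Proof.
elim: n e => [|n IHn] e len.
  have -> : e = 0%N by lia.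
  rewrite /permanent (big_pred1 1%g) ?big_ord0 // => s; apply/esym/eqP/permP.
  by case.
elim: e len => [_|[|e] IHe len].
- rewrite permanent_excS0 lh_polyS0; congr (_ * _).
  by apply: eq_bigr => e _; rewrite IHn.
- by rewrite permanent_excS1 lh_polyS1 IHe ?IHn.
- by rewrite permanent_excSS // lh_polySS // IHe ?IHn // ltnW.
Qed.

Lemma derangement_poly_lh_poly n : derangement_poly n = lh_poly n 0.
Proof. by rewrite derangement_permanent permanent_exc. Qed.

(** * The umbral functional *)

Lemma exprD_subset (R : comNzRingType) (T : finType) (F : {set T}) (a b : R) :
  (a + b) ^+ #|F| = \sum_(S : {set T} | S \subset F) a ^+ (#|F| - #|S|) * b ^+ #|S|.
Proof.
(* Outside [F] the factor is [0 + 1], so distributing the product kills every subset not contained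
   in [F]. *)
transitivity (\prod_i ((if i \in F then b else 0) + (if i \in F then a else 1))).
  rewrite -prodr_const big_mkcond; apply: eq_bigr => i _.
  by case: ifP => _; rewrite ?add0r // addrC.
rewrite bigA_distr [RHS]big_mkcond /=; apply: eq_bigr => S _.
case: ifPn => [sSF | /subsetPn [i iS iF]]; last first.
  by rewrite (bigD1 i) //= iS (negPf iF) mul0r.
rewrite -cardsDS // -!prodr_const mulrC [in RHS]big_mkcond [X in _ = _ * X]big_mkcond.
rewrite -big_split; apply: eq_bigr => i _ /=; rewrite inE.
by case: (boolP (i \in S)) => [/(subsetP sSF) ->|_]; case: (i \in F); rewrite /= ?mulr1 ?mul1r.
Qed.

(* The outer indeterminate is the umbral variable [Y]; scalars are polynomials in [X]. *)
Definition umbral (p : {poly {poly int}}) : {poly int} :=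
  \sum_(i < size p) p`_i * lh_poly i 0.

Lemma umbral_widen N (p : {poly {poly int}}) : (size p <= N)%N ->
  umbral p = \sum_(i < N) p`_i * lh_poly i 0.
Proof.
move=> leN; rewrite /umbral (big_ord_widen _ (fun i => p`_i * lh_poly i 0) leN).
rewrite big_mkcond; apply: eq_bigr => i _; case: ltnP => // le_p.
by rewrite nth_default ?mul0r.
Qed.

Lemma umbral_is_linear : linear_for *%R umbral.
Proof.
move=> c p q; pose N := maxn (size p) (size q).
have pN : (size p <= N)%N by apply: leq_maxl.
have qN : (size q <= N)%N by apply: leq_maxr.
have cpqN : (size (c *: p + q)%R <= N)%N.
  rewrite (leq_trans (size_polyD _ _)) // geq_max qN andbT.
  exact: leq_trans (size_scale_leq _ _) pN.
rewrite (umbral_widen pN) (umbral_widen qN) (umbral_widen cpqN) mulr_sumr -big_split.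
by apply: eq_bigr => i _; rewrite coefD coefZ mulrDl mulrA.
Qed.

HB.instance Definition _ :=
  GRing.isLinear.Build {poly int} {poly {poly int}} {poly int} *%R umbral umbral_is_linear.

Lemma umbralXn n : umbral 'X^n = lh_poly n 0.
Proof.
rewrite (@umbral_widen n.+1) ?size_polyXn // big_ord_recr /= coefXn eqxx mul1r.
by rewrite big1 ?add0r // => i _; rewrite coefXn ltn_eqF // mul0r.
Qed.

(** The factor [Y + 1] acts as [lh_polyS1], and each factor [Y + (1 - X)] as one application of
    [lh_polySS]. *)
Lemma umbral_lh_poly a b :
  umbral (('X + 1) * ('X + (1 - 'X)%:P) ^+ a * 'X^b) = lh_poly (a + b).+1 a.+1.
Proof.
elim: a b => [|a IHa] b.
  by rewrite expr0 mulr1 mulrDl mul1r -exprS linearD /= !umbralXn add0n lh_polyS1.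
pose p : {poly {poly int}} := ('X + 1) * ('X + (1 - 'X)%:P) ^+ a.
have -> : ('X + 1) * ('X + (1 - 'X)%:P) ^+ a.+1 * 'X^b =
    p * 'X^(b.+1) + (1 - 'X)%:P * (p * 'X^b).
  by rewrite /p !exprS; ring.
by rewrite mul_polyC linearD linearZ /= !IHa addnS addSn -lh_polySS //= ltnS leq_addr.
Qed.

(** Both sides are [X] times the sum of [lh_poly n e] over [e <= n]: [lh_poly n.+1 n.+1] is that
    sum, while [lh_poly n.+1 0] is [X] times the sum without its term [e = 0]. *)
Lemma umbral_Xn_shift n :
  umbral ('X^n * ('X + ('X)%:P)) = 'X * umbral (('X + 1) * ('X + (1 - 'X)%:P) ^+ n).
Proof.
have := umbral_lh_poly n 0; rewrite expr0 mulr1 addn0 => ->.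
rewrite mulrDr -exprSr [_ * _%:P]mulrC mul_polyC linearD linearZ /= !umbralXn.
by rewrite lh_polySn lh_polyS0 big_ord_recl mulrDr addrC.
Qed.

(** Linear extension of [umbral_Xn_shift]: substituting [Y + 1 - X] for [Y] turns [Y + X] into
    [Y + 1]. *)
Lemma umbral_shift q :
  umbral (q * ('X + ('X)%:P)) =
  'X * umbral ((q * ('X + ('X)%:P)) \Po ('X + (1 - 'X)%:P)).
Proof.
rewrite -[q]coefK poly_def mulr_suml [in RHS]linear_sum /= !linear_sum mulr_sumr.
apply: eq_bigr => i _; rewrite -scalerAl linearZ /= umbral_Xn_shift.
rewrite linearZ /= linearZ /= mulrCA; congr (_ * (_ * umbral _)).
rewrite comp_polyM rmorphXn /= comp_polyD comp_polyC !comp_polyX mulrC; congr (_ * _).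
by rewrite -addrA -polyCD subrK polyC1.
Qed.

Lemma umbral_exp_rec k :
  umbral (('X + 1) ^+ k) =
  'X * umbral (('X + 1 + (1 - 'X)%:P) ^+ k) + (1 - 'X) ^+ k.+1.
Proof.
have u1 : umbral 1 = 1 by rewrite -(expr0 'X) umbralXn.
have uC c : umbral c%:P = c by rewrite -alg_polyC linearZ /= u1 mulr1.
pose c : {poly {poly int}} := (1 - 'X)%:P.
(* Since [Y + X = (Y + 1) - (1 - X)], this sum is the quotient of [(Y + 1)^k - (1 - X)^k] by
   [Y + X]. *)
have := umbral_shift (\sum_(i < k) ('X + 1) ^+ (k.-1 - i) * c ^+ i).
have -> : 'X + ('X)%:P = 'X + 1 - c :> {poly {poly int}}.
  by rewrite /c -addrA -polyC1 -polyCB; congr (_ + _%:P); ring.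
have -> : (\sum_(i < k) ('X + 1) ^+ (k.-1 - i) * c ^+ i) * ('X + 1 - c) =
    ('X + 1) ^+ k - ((1 - 'X) ^+ k)%:P by rewrite mulrC -subrXX polyC_exp.
rewrite comp_polyB comp_polyC (rmorphXn (comp_poly _)) /= comp_polyD comp_polyX rmorph1.
rewrite !linearB /= !uC ['X + _ + 1]addrAC => /eqP; rewrite subr_eq => /eqP ->.
by rewrite exprS; ring.
Qed.

(** Brings [umbral_exp_rec] to the shape of [bary_h_rec]. The empty subset contributes
    [X (1 - X)^k], which together with [(1 - X)^(k+1)] makes [(1 - X)^k]. *)
Lemma umbral_exp_subset (T : finType) (F : {set T}) :
  umbral (('X + 1) ^+ #|F|) =
  (1 - 'X) ^+ #|F| + 'X * \sum_(S : {set T} | (S != set0) && (S \subset F))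
     (1 - 'X) ^+ (#|F| - #|S|) * umbral (('X + 1) ^+ #|S|).
Proof.
have -> : umbral (('X + 1) ^+ #|F|) = 'X * \sum_(S : {set T} | S \subset F)
    (1 - 'X) ^+ (#|F| - #|S|) * umbral (('X + 1) ^+ #|S|) + (1 - 'X) ^+ #|F|.+1.
  rewrite umbral_exp_rec [_ + _%:P]addrC exprD_subset linear_sum /=.
  congr (_ * _ + _); apply: eq_bigr => S _.
  by rewrite -polyC_exp mul_polyC linearZ.
rewrite (bigD1 set0) ?sub0set //= cards0 subn0 expr0 -(expr0 'X) umbralXn lh_poly00.
rewrite exprS; under [in RHS]eq_bigl do rewrite andbC.
by ring.
Qed.

(** * Chains, the barycentric subdivision and its local h-polynomial *)

Lemma chain_card (T : finType) k (C : {set {set T}}) :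
    [forall S in C, (S != set0) && (#|S| <= k)%N] ->
    [forall S in C, forall S' in C, (S \subset S') || (S' \subset S)] ->
  (#|C| <= k)%N.
Proof.
move=> /forall_inP Ck /forall_inP chainC.
(* A chain has at most one member of each size, and the sizes lie in [1..k]. *)
have inj_card : {in C &, injective (fun S : {set T} => #|S|)}.
  move=> S S' SC S'C eq_card; have /forall_inP/(_ _ S'C) := chainC _ SC.
  case/orP=> [le|le]; [apply/eqP | apply/esym/eqP].
    by rewrite eqEcard le eq_card leqnn.
  by rewrite eqEcard le eq_card leqnn.
rewrite cardE -(size_map (fun S : {set T} => #|S|)) -(size_iota 1 k).
apply: uniq_leq_size.
  by rewrite map_inj_in_uniq ?enum_uniq // => S S'; rewrite !mem_enum; apply: inj_card.
move=> _ /mapP [S + ->]; rewrite mem_enum mem_iota => /Ck /andP [S0 leS].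
by rewrite card_gt0 S0 add1n ltnS.
Qed.

Lemma bary_restrP n (F : {set 'I_n}) (C : {set {set 'I_n}}) :
  reflect ((forall S, S \in C -> S != set0 /\ S \subset F) /\
           (forall S S', S \in C -> S' \in C -> (S \subset S') || (S' \subset S)))
    (C \in bary_restr F).
Proof.
rewrite inE; apply: (iffP andP) => [[/forall_inP sub /forall_inP chain]|[sub chain]].
  split=> [S /sub /andP // | S S' SC]; exact: (forall_inP (chain S SC)).
split; apply/forall_inP => S SC; first by apply/andP; apply: sub.
by apply/forall_inP => S' S'C; apply: chain.
Qed.

Lemma bary_card n (F : {set 'I_n}) (C : {set {set 'I_n}}) :
  C \in bary_restr F -> (#|C| <= #|F|)%N.
Proof.
move=> CF; have /bary_restrP [sub _] := CF; move: CF; rewrite inE => /andP [_].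
apply: chain_card; apply/forall_inP => S /sub [-> sSF].
by rewrite subset_leq_card.
Qed.

Lemma bary_card_proper n (F : {set 'I_n}) (C : {set {set 'I_n}}) :
  C \in bary_restr F -> F \notin C -> (#|C| <= #|F|.-1)%N.
Proof.
move=> CF nFC; have /bary_restrP [sub _] := CF; move: CF; rewrite inE => /andP [_].
apply: chain_card; apply/forall_inP => S SC; have [-> sSF] := sub _ SC.
have: S \proper F by rewrite properEneq sSF andbT; apply: contraNneq nFC => <-.
by move/proper_card => ltSF; lia.
Qed.

(** The member of largest size contains all others, so it is the union. Sorting nonempty chains by
    [cover] thus sorts them by top element. *)
Lemma cover_chain (T : finType) (C : {set {set T}}) : C != set0 ->
    (forall S S', S \in C -> S' \in C -> (S \subset S') || (S' \subset S)) ->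
  cover C \in C.
Proof.
case/set0Pn=> S0 S0C chain; case: (arg_maxnP (fun S : {set T} => #|S|) S0C) => S SC maxS.
suff -> : cover C = S by [].
apply/eqP; rewrite eqEsubset; apply/andP; split; last exact: bigcup_sup.
apply/bigcupsP => S' S'C; have /orP [//|sSS'] := chain _ _ S'C SC.
by have /eqP -> : S == S' by rewrite eqEcard sSS'; apply: maxS.
Qed.

Definition bary_h n (F : {set 'I_n}) : {poly int} :=
  \sum_(C in bary_restr F) 'X^(#|C|) * (1 - 'X) ^+ (#|F| - #|C|).

Lemma h_poly_bary n (F : {set 'I_n}) : h_poly #|F| (bary_restr F) = bary_h F.
Proof.
rewrite /h_poly /bary_h.
rewrite (partition_big (fun C : {set {set 'I_n}} => inord #|C| : 'I_(#|F|.+1)) predT) //=.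
apply: eq_bigr => i _; rewrite -sum1_card natr_sum scaler_suml.
apply: eq_big => [C|C].
  rewrite in_set; case CF: (C \in _) => //=.
  by rewrite -val_eqE /= inordK // ltnS bary_card.
by rewrite in_set => /andP [_ /eqP ->]; rewrite scale1r.
Qed.

(* The chains avoiding [F] triangulate the boundary of [2^F], hence the exponent. *)
Definition bary_h_proper n (F : {set 'I_n}) : {poly int} :=
  \sum_(C in bary_restr F | F \notin C) 'X^(#|C|) * (1 - 'X) ^+ (#|F|.-1 - #|C|).

(** Adjoining [S] matches the chains inside [S] that avoid [S] with the chains in [F] with top [S];
    the left side is the condition produced by [reindex_onto]. *)
Lemma bary_cone n (F S : {set 'I_n}) (C : {set {set 'I_n}}) :
    S \subset F -> S != set0 ->
  [&& S |: C \in bary_restr F, cover (S |: C) == S & (S |: C) :\ S == C] =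
  (C \in bary_restr S) && (S \notin C).
Proof.
move=> sSF S0; apply/and3P/andP => [[/bary_restrP [sub chain] /eqP cov /eqP eqC]|].
  have nSC : S \notin C by rewrite -eqC setD11.
  split=> //; apply/bary_restrP; split=> [T TC | T T' TC T'C]; last first.
    by apply: chain; rewrite setU1r.
  have TD : T \in S |: C by rewrite setU1r.
  by split; [case: (sub T TD) | rewrite -cov; apply: bigcup_sup].
move=> [/bary_restrP [sub chain] nSC]; split; last by rewrite setU1K.
  apply/bary_restrP; split=> [T | T T'].
    case/setU1P => [-> // | /sub [T0 sTS]]; split=> //; exact: subset_trans sSF.
  case/setU1P => [->|TC] /setU1P [->|T'C]; first by rewrite subxx.
  - by have [_ ->] := sub _ T'C; rewrite orbT.
  - by have [_ ->] := sub _ TC.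
  - exact: chain.
rewrite eqEsubset (bigcup_sup S) ?setU11 // andbT.
by apply/bigcupsP => T /setU1P [-> // | /sub []].
Qed.

Lemma sum_bary_cover n (F S : {set 'I_n}) (f : {set {set 'I_n}} -> {poly int}) :
    S \subset F -> S != set0 ->
  \sum_(C in bary_restr F | cover C == S) f C =
  \sum_(C in bary_restr S | S \notin C) f (S |: C).
Proof.
move=> sSF S0; rewrite (reindex_onto (fun C => S |: C) (fun C => C :\ S)) /=.
  by apply: eq_bigl => C; rewrite -andbA bary_cone.
move=> C /andP [/bary_restrP [_ chain] /eqP cov]; apply: setD1K.
rewrite -[X in X \in _]cov; apply: cover_chain => //.
by apply: contraNneq S0 => C0; rewrite -cov C0 /cover big_set0.
Qed.

(** The subdivision is a cone with apex [F] over its boundary, and coning preserves the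
    h-polynomial: the terms of [C] and [F |: C] add up by [(1 - 'X) + 'X = 1]. *)
Lemma bary_h_top n (F : {set 'I_n}) : F != set0 -> bary_h F = bary_h_proper F.
Proof.
move=> F0; rewrite /bary_h (bigID (fun C => cover C == F)) /= sum_bary_cover //.
have notcover C : (C \in bary_restr F) && (cover C != F) =
    (C \in bary_restr F) && (F \notin C).
  case CF: (C \in _) => //=; have /bary_restrP [sub chain] := CF; congr negb.
  apply/eqP/idP => [cov | FC].
    rewrite -[X in X \in _]cov; apply: cover_chain => //.
    by apply: contraNneq F0 => C0; rewrite -cov C0 /cover big_set0.
  apply/eqP; rewrite eqEsubset (bigcup_sup F) // andbT.
  by apply/bigcupsP => S /sub [].
rewrite (eq_bigl _ _ notcover) -big_split; apply: eq_bigr => C /andP [CF nFC] /=.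
have ltCF := bary_card_proper CF nFC; have F_gt0 : (0 < #|F|)%N by rewrite card_gt0.
rewrite cardsU1 nFC add1n.
have -> : (#|F| - #|C|.+1 = #|F|.-1 - #|C|)%N by lia.
have -> : (#|F| - #|C| = (#|F|.-1 - #|C|).+1)%N by lia.
rewrite !(exprS _ #|C|) (exprS _ (_ - _)).
by move: ('X^(#|C|) : {poly int}) ((1 - 'X) ^+ (_ - _)) => u v; ring.
Qed.

(** Chains are sorted by top element [S]; the empty chain gives the first term, and [bary_h_top]
    turns the chains below [S] into [bary_h S]. *)
Lemma bary_h_rec n (F : {set 'I_n}) :
  bary_h F = (1 - 'X) ^+ #|F| + 'X * \sum_(S : {set 'I_n} | (S != set0) && (S \subset F))
     (1 - 'X) ^+ (#|F| - #|S|) * bary_h S.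
Proof.
rewrite {1}/bary_h (partition_big (@cover _) (fun S => S \subset F)) /=; last first.
  by move=> C /bary_restrP [sub _]; apply/bigcupsP => S /sub [].
rewrite (bigD1 set0) ?sub0set //=; congr (_ + _).
  rewrite (big_pred1 set0) ?cards0 ?subn0 ?mul1r // => C.
  apply/andP/eqP => [[/bary_restrP [sub _] /eqP cov] | ->].
    apply/eqP; rewrite -subset0; apply/subsetP => S SC; have [S0 _] := sub S SC.
    by case/negP: S0; rewrite -subset0 -cov; apply: bigcup_sup.
  by split; [apply/bary_restrP; split=> S; rewrite ?inE | rewrite /cover big_set0].
rewrite mulr_sumr; apply: eq_big => [S | S /andP [sSF S0]]; first by rewrite andbC.
rewrite sum_bary_cover // bary_h_top // /bary_h_proper !mulr_sumr.
apply: eq_bigr => C /andP [CS nSC].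
have ltCS := bary_card_proper CS nSC; have S_gt0 : (0 < #|S|)%N by rewrite card_gt0.
have leSF := subset_leq_card sSF.
rewrite cardsU1 nSC add1n.
have -> : (#|F| - #|C|.+1 = (#|F| - #|S|) + (#|S|.-1 - #|C|))%N by lia.
rewrite (exprS _ #|C|) exprD.
by move: ('X^(#|C|) : {poly int}) ((1 - 'X) ^+ (_ - #|C|)) ((1 - 'X) ^+ _) => u v w; ring.
Qed.

Lemma bary_h_umbral n (F : {set 'I_n}) : bary_h F = umbral (('X + 1) ^+ #|F|).
Proof.
elim: {F}_.+1 {-2}F (ltnSn #|F|) => // m IHm F; rewrite ltnS => leF.
have [-> | F0] := eqVneq F set0.
  rewrite bary_h_rec umbral_exp_subset !big_pred0 // => S.
    by rewrite subset0; case: eqP.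
  by rewrite subset0; case: eqP.
(* Both recursions contain the term [S = F], so the induction only shows that the difference equals
   ['X] times itself; it vanishes because [1 - 'X] is nonzero. *)
have : bary_h F - umbral (('X + 1) ^+ #|F|) =
    'X * (bary_h F - umbral (('X + 1) ^+ #|F|)).
  rewrite {1}bary_h_rec {1}umbral_exp_subset (bigD1 F) ?F0 //= [in X in _ - X](bigD1 F) ?F0 //=.
  rewrite subnn expr0 !mul1r.
  rewrite (eq_bigr (fun S : {set 'I_n} =>
    (1 - 'X) ^+ (#|F| - #|S|) * umbral (('X + 1) ^+ #|S|))); first by ring.
  move=> S /andP [/andP [_ sSF] neq]; rewrite IHm //.
  by apply: leq_trans leF; apply: proper_card; rewrite properEneq neq.
move/eqP; rewrite -subr_eq0 -{1}[_ - umbral _]mul1r -mulrBl mulf_eq0.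
case/orP=> [/eqP/(congr1 (fun p : {poly int} => p.[0])) | ].
  by rewrite !hornerE => /eqP; rewrite oner_eq0.
by rewrite subr_eq0 => /eqP.
Qed.

Lemma local_h_lh_poly n : local_h (@bary_restr n) = lh_poly n 0.
Proof.
(* Writing [Y = -1 + (Y + 1)] makes the expansion over subsets the alternating sum over faces. *)
have -> : lh_poly n 0 = umbral ((-1 + ('X + 1)) ^+ #|[set: 'I_n]|).
  by rewrite addrC addrK cardsT card_ord umbralXn.
rewrite exprD_subset linear_sum cardsT card_ord /=.
apply: eq_big => [F | F _]; first by rewrite subsetT.
rewrite h_poly_bary bary_h_umbral -signr_odd scaler_sign -[in RHS]signr_odd mulr_sign.
by case: odd; rewrite ?linearN.
Qed.

(** * Counting integer sequences step by step *)

Lemma size_lh_poly n e : (size (lh_poly n e) <= maxn 1 n)%N.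
Proof.
have max1 k : maxn 1 k.+1 = k.+1 by apply/maxn_idPr.
elim: n e => [|n IHn] e.
  by rewrite /lh_poly; case: (e == 0); rewrite ?size_poly1 ?size_poly0.
(* At index [1] the only predecessor is [0], which never yields a factor ['X]; this saves one
   degree. *)
case: n IHn => [|n] IHn.
  rewrite lh_polyS big_ord1 lh_poly00 /=; case: e => [|e] /=; first by rewrite mul0r size_poly0.
  by rewrite mulr1 size_poly1.
rewrite max1 lh_polyS; apply: (leq_trans (size_sum _ _ _)).
apply/bigmax_leqP => i _; have lei := IHn i; rewrite max1 in lei.
case: ifP => _; first by rewrite mul1r ltnW.
case: ifP => _; first by rewrite mul0r size_poly0.
have [->|nz] := eqVneq (lh_poly n.+1 i) 0; first by rewrite mulr0 size_poly0.
by rewrite mulrC size_mulX.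
Qed.

(** The condition [0 < x' / (j + 2) - x / (j + 1) < 1] with denominators cleared. *)
Definition lh_step (j : nat) (x x' : int) : bool :=
  0 < x' * j.+1%:Z - x * j.+2%:Z < (j.+1 * j.+2)%:Z.

(** The ratios differ by [k - a] plus a fractional part in [(-1, 1)], which is positive iff [e < e']
    and zero iff [e = e' = 0]. Hence [k - a] must be [0] in the positive case and [1] in the
    negative one, and no value fits zero. *)
Lemma lh_step_divmod j k a e e' : (e <= j)%N -> (e' <= j.+1)%N ->
  lh_step j (a * j.+1 + e)%:Z (k * j.+2 + e')%:Z =
  if (e < e')%N then a == k else
  if (e == 0) && (e' == 0) then false else a.+1 == k.
Proof.
move=> le_ej le_ej'; rewrite /lh_step.
have -> : (k * j.+2 + e')%:Z * j.+1%:Z - (a * j.+1 + e)%:Z * j.+2%:Z =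
    (k%:Z - a%:Z) * (j.+1 * j.+2)%:Z + (e'%:Z * j.+1%:Z - e%:Z * j.+2%:Z).
  by rewrite !PoszD !PoszM; ring.
have D_gt0 : 0 < (j.+1 * j.+2)%:Z by [].
have DE : (j.+1 * j.+2)%:Z = j.+1%:Z * j.+2%:Z by rewrite PoszM.
set D := (j.+1 * j.+2)%:Z in D_gt0 DE *; set d := _ - e%:Z * _.
have window (p : int) : - D < d < D -> (0 < p * D + d < D) =
    if 0 < d then p == 0 else if d == 0 then false else p == 1.
  move=> /andP [? ?]; case: (ltrP 0 d) => ?; last case: (eqVneq d 0) => [-> | ?].
  - by apply/andP/eqP => [[? ?] | ->]; [nia | lia].
  - by apply/negbTE/andP => -[? ?]; have [?|?] : p <= 0 \/ 1 <= p by [lia|]; nia.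
  - by apply/andP/eqP => [[? ?] | ->]; [nia | lia].
rewrite window; last first.
  rewrite /d DE; apply/andP; split; nia.
case: ltnP => [lt_ee' | le_e'e].
  have -> : 0 < d by rewrite /d; nia.
  by rewrite subr_eq0 eqz_nat eq_sym.
have -> : (0 < d) = false by apply/negbTE; rewrite -leNgt /d; nia.
have -> : (d == 0) = (e == 0) && (e' == 0).
  by rewrite /d; apply/eqP/andP => [d0 | [/eqP -> /eqP ->]]; [split; nia | ring].
case: ifP => // _; lia.
Qed.

Definition lh_coef (j x : nat) : int := (lh_poly j (x %% j.+1))`_(x %/ j.+1).

Lemma sum_nat_divmod (M j : nat) (f : nat -> int) :
  \sum_(x < M * j.+1) f x = \sum_(e < j.+1) \sum_(a < M) f (a * j.+1 + e)%N.
Proof.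
rewrite exchange_big /=; elim: M => [|M IHM]; first by rewrite mul0n !big_ord0.
rewrite [RHS]big_ord_recr /= -IHM -!(big_mkord xpredT) /=.
rewrite (big_cat_nat (n := M * j.+1)) //= ?leq_mul2r ?leqnSn ?orbT //; congr (_ + _).
rewrite -{1}[(M * j.+1)%N]add0n big_addn mulSn addnK.
by rewrite big_mkord; apply: eq_bigr => i _; rewrite addnC.
Qed.

Lemma lh_coef_eq0 j x : (maxn 1 j * j.+1 <= x)%N -> lh_coef j x = 0.
Proof.
move=> lex; apply: nth_default; apply: leq_trans (size_lh_poly _ _) _.
by rewrite leq_divRL.
Qed.

(** Coefficientwise form of the recurrence: for each remainder [e], at most one quotient, [k] or
    [k - 1], admits a step. The bound on [N] covers the support of [lh_coef j]. *)
Lemma lh_coefS j x' N : (maxn 1 j * j.+1 <= N)%N ->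
  lh_coef j.+1 x' = \sum_(x < N) lh_coef j x * (lh_step j x x')%:R.
Proof.
move=> leN; set k := (x' %/ j.+2)%N; set e' := (x' %% j.+2)%N.
pose f (x : nat) := lh_coef j x * (lh_step j x x')%:R.
(* A range of length [M * j.+1] splits by quotient and remainder, and [k < M] keeps the needed
   quotients in range. *)
pose M := maxn N k.+1.
have -> : \sum_(x < N) f x = \sum_(x < M * j.+1) f x.
  have leNM : (N <= M * j.+1)%N.
    by apply: leq_trans (leq_maxl N k.+1) _; rewrite leq_pmulr.
  rewrite (big_ord_widen _ f leNM) big_mkcond; apply: eq_bigr => x _.
  case: ltnP => // lex; rewrite /f lh_coef_eq0 ?mul0r //.
  exact: leq_trans leN lex.
rewrite sum_nat_divmod /lh_coef -/k -/e' lh_polyS coef_sum.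
apply: eq_bigr => e _.
have le_e : (e <= j)%N by rewrite -ltnS.
have le_e' : (e' <= j.+1)%N by rewrite -ltnS ltn_mod.
have fE (a : 'I_M) : f (a * j.+1 + e)%N = (lh_poly j e)`_a *
    (if (e < e')%N then a == k :> nat else
     if (e == 0 :> nat) && (e' == 0) then false else a.+1 == k)%:R.
  rewrite /f /lh_coef divnMDl // modnMDl modn_small // divn_small // addn0.
  by rewrite (divn_eq x' j.+2) lh_step_divmod.
rewrite (eq_bigr _ (fun a _ => fE a)).
have pick (b : nat) : (b < M)%N ->
    \sum_(a < M) (lh_poly j e)`_a * (a == b :> nat)%:R = (lh_poly j e)`_b.
  move=> ltbM; rewrite (bigD1 (Ordinal ltbM)) //= eqxx mulr1 big1 ?addr0 // => i.
  by rewrite -val_eqE /= => /negPf ->; rewrite mulr0.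
have ltkM : (k < M)%N by rewrite leq_maxr.
case: ifP => _; first by rewrite mul1r pick.
case: ifP => _; first by rewrite mul0r coef0 big1 // => a _; rewrite mulr0.
rewrite mulrC coefMX; move: (k) ltkM => [|b] ltbM /=.
  by rewrite big1 // => a _; rewrite mulr0.
by under eq_bigr do rewrite eqSS; rewrite pick // ltnW.
Qed.

(** Transfer-matrix method: the induction peels off the last coordinate and absorbs its weight into
    [F]. *)
Lemma transfer_sum (A : comNzRingType) (I : finType) (w0 : I -> A)
    (w : nat -> I -> I -> A) (T : nat -> I -> A) m (F : I -> A) :
    T 0%N =1 w0 -> (forall j x', (j < m)%N -> T j.+1 x' = \sum_x T j x * w j x x') ->
  \sum_(y : {ffun 'I_m.+1 -> I})
     w0 (y (inord 0)) * (\prod_(i < m) w i (y (inord i)) (y (inord i.+1))) * F (y (inord m)) =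
  \sum_x T m x * F x.
Proof.
move=> T0; elim: m F => [|m IHm] F TS.
  pose h (x : I) : {ffun 'I_1 -> I} := [ffun => x].
  rewrite (reindex h); last first.
    exists (fun y : {ffun 'I_1 -> I} => y ord0) => [x _ | y _]; first by rewrite ffunE.
    by apply/ffunP => i; rewrite ffunE [i]ord1.
  by apply: eq_bigr => x _; rewrite big_ord0 mulr1 !ffunE T0.
pose h (u : {ffun 'I_m.+1 -> I} * I) : {ffun 'I_m.+2 -> I} :=
  [ffun i : 'I_m.+2 => if (i < m.+1)%N then u.1 (inord i) else u.2].
have hE u k : (k < m.+1)%N -> h u (inord k) = u.1 (inord k).
  by move=> ltk; rewrite ffunE inordK ?ltk // ltnW.
have hn u : h u (inord m.+1) = u.2 by rewrite ffunE inordK ?ltnn.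
rewrite (reindex h); last first.
  exists (fun y : {ffun 'I_m.+2 -> I} =>
      ([ffun i : 'I_m.+1 => y (inord i)], y (inord m.+1))) => [u _ | y _].
    rewrite hn; case: u hE {hn} => y x hE; congr (_, _); apply/ffunP => i.
    by rewrite ffunE hE //= inord_val.
  apply/ffunP => i; rewrite ffunE /=; case: ifP => lti.
    by rewrite ffunE inordK // inord_val.
  congr (y _); apply/val_inj; rewrite /= inordK //.
  by have := ltn_ord i; move: lti => /=; lia.
rewrite -(pair_bigA _ (fun y x => w0 (h (y, x) (inord 0)) *
  (\prod_(i < m.+1) w i (h (y, x) (inord i)) (h (y, x) (inord i.+1))) *
  F (h (y, x) (inord m.+1)))) exchange_big /=.
apply: eq_bigr => x _; rewrite TS // mulr_suml.
transitivity (\sum_x' T m x' * (w m x' x * F x)); last first.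
  by apply: eq_bigr => x' _; rewrite mulrA.
rewrite -(IHm (fun x' => w m x' x * F x)) => [|j x' ltj]; last by rewrite TS // ltnW.
apply: eq_bigr => y _; rewrite big_ord_recr /= !hn !hE // !mulrA; congr (_ * _ * _ * _).
by apply: eq_bigr => i _; rewrite !hE // ltnS // ltnW.
Qed.

(** * Lattice points of the open parallelepiped *)

Lemma sum_ord_shift B (f : nat -> int) :
  \sum_(x < B.*2.+1) (if x%:Z - B%:Z is Posz k then f k else 0) = \sum_(k < B.+1) f k.
Proof.
rewrite -(big_mkord xpredT (fun x : nat => if x%:Z - B%:Z is Posz k then f k else 0)).
rewrite (big_cat_nat (n := B)) //=; last by rewrite -addnn leqW // leq_addr.
rewrite big_nat big1 ?add0r => [|x /andP [_ ltxB]]; last first.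
  by have -> : x%:Z - B%:Z = Negz (B - x).-1 by rewrite NegzE; lia.
rewrite -{1}[B]add0n big_addn big_mkord.
have -> : (B.*2.+1 - B = B.+1)%N by rewrite -addnn; lia.
by apply: eq_bigr => x _; rewrite PoszD addrK.
Qed.

(** Only the vertices [i <= j] have a nonzero coordinate [j], so partial sums of the coefficients
    appear. *)
Lemma sum_lhs_vertex (K : comNzRingType) m (l : nat -> K) (j : 'I_m.+1) :
  \sum_(i < m.+2) l i * (lhs_vertex (@s_seq m.+2) i j)%:~R =
  j.+2%:R * \sum_(i < j.+1) l i.
Proof.
rewrite (big_ord_widen m.+2 l); last exact: leqW (ltn_ord j).
rewrite mulr_sumr [RHS]big_mkcond; apply: eq_bigr => i _.
by rewrite /lhs_vertex ltnS /s_seq addn2; case: ifP; rewrite ?mulr0 // mulrC.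
Qed.

(* Shifts the coordinates by one and pads them with [0] and [t (m + 3)]: with
   [c_k = par_num y t k / (k + 1)], the barycentric coefficients become
   [lambda_k = c_(k+1) - c_k]. *)
Definition par_num m (y : 'I_m.+1 -> int) (t : int) (k : nat) : int :=
  if k is k'.+1 then if (k' < m.+1)%N then y (inord k') else t * m.+3%:Z else 0.

Lemma lh_stepP (K : realFieldType) j (x x' : int) (l : K) :
  l = x'%:~R / j.+2%:R - x%:~R / j.+1%:R -> lh_step j x x' = (0 < l < 1).
Proof.
move=> lE.
have D0 : 0 < (j.+1 * j.+2)%:R :> K by rewrite ltr0n.
have -> : (0 < l < 1) = (0 < (j.+1 * j.+2)%:R * l < (j.+1 * j.+2)%:R).
  by rewrite pmulr_rgt0 // gtr_pMr.
have -> : (j.+1 * j.+2)%:R * l = (x' * j.+1%:Z - x * j.+2%:Z)%:~R.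
  have j1 : j.+1%:R != 0 :> K by rewrite pnatr_eq0.
  have j2 : j.+2%:R != 0 :> K by rewrite pnatr_eq0.
  rewrite lE rmorphB !rmorphM /= natrM -!pmulrn.
  move: (j.+1%:R) (j.+2%:R) (x%:~R) (x'%:~R) j1 j2 => a b u v a0 b0.
  by field; rewrite a0 b0.
by rewrite [(_ * _)%:R]pmulrn ltr0z ltr_int.
Qed.

(** The coefficients and the ratios [c k] determine each other: [c k] is the sum of the first [k]
    coefficients, and these are its consecutive differences. *)
Lemma in_open_parP m (y : 'I_m.+1 -> int) (t : int) :
  in_open_par (lhs_vertex (@s_seq m.+2)) y t <->
  (forall i, (i < m.+2)%N -> lh_step i (par_num y t i) (par_num y t i.+1)).
Proof.
pose K : realFieldType := Rdefinitions.R; pose c k : K := (par_num y t k)%:~R / k.+1%:R.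
have c0 : c 0%N = 0 by rewrite /c mul0r.
have cj (j : 'I_m.+1) : j.+2%:R * c j.+1 = (y j)%:~R.
  by rewrite /c /= ltn_ord inord_val mulrC divfK // pnatr_eq0.
have ct : c m.+2 = t%:~R.
  by rewrite /c /= ltnn rmorphM /= -pmulrn mulfK // pnatr_eq0.
split=> [[lam [lam01 [yE tE]]] i lti | steps].
  pose l k := lam (inord k).
  have lE (k : 'I_m.+2) : lam k = l k by rewrite /l inord_val.
  have sum_l k : (k <= m.+2)%N -> c k = \sum_(i < k) l i.
    case: k => [|k]; first by rewrite big_ord0.
    rewrite ltnS leq_eqVlt => /predU1P [-> | ltk].
      by rewrite ct tE; apply: eq_bigr => j _; rewrite lE.
    have := cj (Ordinal ltk); rewrite yE.
    under eq_bigr do rewrite lE.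
    by rewrite sum_lhs_vertex /= => /mulfI -> //; rewrite pnatr_eq0.
  rewrite (@lh_stepP K i _ _ (c i.+1 - c i)) // !sum_l ?(ltnW lti) //.
  by rewrite big_ord_recr /= addrAC subrr add0r; apply: lam01.
pose l k := c k.+1 - c k.
have sum_l k : \sum_(i < k) l i = c k.
  by rewrite -(big_mkord xpredT) telescope_sumr // c0 subr0.
exists (fun i => l i); split=> [i | ].
  by rewrite -(@lh_stepP K i (par_num y t i) (par_num y t i.+1)) // steps.
split=> [j|]; last by rewrite sum_l ct.
by rewrite sum_lhs_vertex sum_l cj.
Qed.

(** Makes the box of [lstar] contain the support of [lh_coef j.+1]: in coordinate [j], each of the
    vertices [0..j] contributes [j + 2]. *)
Lemma par_bound_lhs m (j : nat) : (j <= m)%N ->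
  (j.+1 * j.+2 <= par_bound (lhs_vertex (@s_seq m.+2)))%N.
Proof.
move=> lejm; have ltj : (j < m.+1)%N by [].
rewrite /par_bound exchange_big /= (bigD1 (Ordinal ltj)) //=.
apply: (@leq_trans (\sum_(i < m.+2) `|lhs_vertex (@s_seq m.+2) i (Ordinal ltj)|)); last first.
  by rewrite leqW // leq_addr.
rewrite (eq_bigr (fun i : 'I_m.+2 => if (i < j.+1)%N then j.+2 else 0%N)) => [|i _].
  rewrite -big_mkcond -(big_ord_widen m.+2 (fun=> j.+2)) ?sum_nat_const ?card_ord //.
  exact: leqW.
by rewrite /lhs_vertex ltnS /s_seq /= addn2; case: ifP.
Qed.

Lemma natr_forall (A : comNzRingType) n (b : 'I_n -> bool) :
  [forall i, b i]%:R = \prod_i (b i)%:R :> A.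
Proof.
case: forallP => [bP | /forallP]; first by rewrite big1 // => i _; rewrite bP.
by rewrite negb_forall => /existsP [i /negPf bi]; rewrite (bigD1 i) //= bi mul0r.
Qed.

Lemma count_in_open_par m t (B := par_bound (lhs_vertex (@s_seq m.+2))) :
  \sum_(y : {ffun 'I_m.+1 -> 'I_(B.*2.+1)})
    `[< in_open_par (lhs_vertex (@s_seq m.+2)) (fun j => (y j)%:Z - B%:Z) t%:Z >]%:R =
  (lh_poly m.+2 0)`_t :> int.
Proof.
pose I := 'I_(B.*2.+1); pose X (x : I) : int := x%:Z - B%:Z.
pose w0 (x : I) : int := (lh_step 0 0 (X x))%:R.
pose w j (x x' : I) : int := (lh_step j.+1 (X x) (X x'))%:R.
pose F (x : I) : int := (lh_step m.+1 (X x) (t%:Z * m.+3%:Z))%:R.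
(* Ratios increase from [0], so negative coordinates are never reached. *)
pose T j (x : I) : int := if X x is Posz k then lh_coef j.+1 k else 0.
have leB j : (j <= m)%N -> (maxn 1 j.+1 * j.+2 <= B.+1)%N.
  by move=> /par_bound_lhs lejB; rewrite (maxn_idPr _) // leqW.
transitivity (\sum_(y : {ffun 'I_m.+1 -> I}) w0 (y (inord 0)) *
    (\prod_(i < m) w i (y (inord i)) (y (inord i.+1))) * F (y (inord m))).
  apply: eq_bigr => y _; set p := par_num (fun j => X (y j)) t%:Z.
  have -> : `[< in_open_par (lhs_vertex (@s_seq m.+2)) (fun j => X (y j)) t%:Z >] =
      [forall i : 'I_m.+2, lh_step i (p i) (p i.+1)].
    apply/asboolP/forallP => [/in_open_parP steps i | steps]; first exact: steps.
    by apply/in_open_parP => i lti; apply: (steps (Ordinal lti)).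
  rewrite natr_forall big_ord_recl big_ord_recr /= mulrA /p /= ltnn ltnSn.
  congr (_ * _ * _); apply: eq_bigr => i _.
  by rewrite /w /= /bump /= !add1n add0n !ltnS (ltnW (ltn_ord i)) (ltn_ord i).
rewrite (@transfer_sum _ _ w0 w T m F) => [| x | j x' ltjm].
(* The final value [t (m + 3)] has quotient [t] and remainder [0] modulo [m + 3]. *)
- rewrite (_ : (lh_poly m.+2 0)`_t = lh_coef m.+2 (t * m.+3)); last first.
    by rewrite /lh_coef mulnK // modnMl.
  rewrite (lh_coefS _ (leB m (leqnn m))).
  rewrite -(sum_ord_shift B
    (fun k : nat => lh_coef m.+1 k * (lh_step m.+1 k (t * m.+3)%N)%:R)).
  apply: eq_bigr => x _.
  by rewrite /T /F PoszM -/(X x); case: (X x) => k; rewrite ?mul0r.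
- rewrite /T /w0; case: (X x) => k; last by rewrite /lh_step.
  by rewrite (@lh_coefS 0 k 1) // big_ord1 /lh_coef lh_poly00 coef1 mul1r.
rewrite /T; case EX': (X x') => [k'|k'].
  rewrite (lh_coefS _ (leB j (ltnW ltjm))).
  rewrite -(sum_ord_shift B (fun k : nat => lh_coef j.+1 k * (lh_step j.+1 k k')%:R)).
  apply: eq_bigr => x _.
  by rewrite /w EX' -/(X x); case: (X x) => k; rewrite ?mul0r.
rewrite big1 // => x _; rewrite /w EX'; case: (X x) => k; last by rewrite mul0r.
by rewrite (_ : lh_step _ _ _ = false) ?mulr0 // /lh_step NegzE; lia.
Qed.

Lemma s_derangement_lh_poly m : s_derangement (@s_seq m.+2) = lh_poly m.+2 0.
Proof.
(* The degree bound matches the range of [t] in [lstar]. *)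
have -> : lh_poly m.+2 0 = \poly_(t < m.+2) (lh_poly m.+2 0)`_t.
  apply/polyP => t; rewrite coef_poly; case: ltnP => // let_.
  by rewrite nth_default //; apply: leq_trans (size_lh_poly _ _) _.
rewrite poly_def /s_derangement /lstar exchange_big /=; apply: eq_bigr => t _.
rewrite -count_in_open_par scaler_suml; apply: eq_bigr => y _.
by case: asboolP; rewrite ?scale1r ?scale0r.
Qed.

Theorem theorem4p1 (n : nat) (hn : (2 <= n)%N) :
  s_derangement (s_seq n) = derangement_poly n /\
  local_h (@bary_restr n) = s_derangement (s_seq n).
Proof.
case: n hn => [|[|m]] // _.
by rewrite local_h_lh_poly s_derangement_lh_poly derangement_poly_lh_poly.
Qed.
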